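(* Let $D$ be a discrete derivative operator of order $p>2$. Then there is no averaging operator $A$ of any order $q\in\mathbb{N}$ such that the product rule $$D(\mathbf{u}\mathbf{v})=(A\mathbf{u})(D\mathbf{v})+(D\mathbf{u})(A\mathbf{v})$$ holds for all scalar-valued grid functions $\mathbf{u},\mathbf{v}$.
   Context: Consider (possibly non-uniform) grids with distinct ordered nodes $x_i\in\mathbb{R}$ and $h:=\min_i(x_{i+1}-x_i)>0$; asymptotic statements $\mathcal{O}(h^r)$ refer to a family of such grids with $h\to0$. A grid function is a family $\mathbf{u}=(\mathbf{u}_i)_i$ of real values at the nodes; a function $u$ gives the grid function $\mathbf{u}_i=u(x_i)$. Products of grid functions are pointwise: $(\mathbf{u}\mathbf{v})_i=\mathbf{u}_i\mathbf{v}_i$. A discrete derivative operator $D$ is a linear operator on grid functions on each grid of the family, given by a matrix: $(D\mathbf{u})_i=\sum_j D_{ij}\mathbf{u}_j$ (finite sums). It is of order $p$ if $(D\mathbf{u})_i=u'(x_i)+\mathcal{O}(h^p)$ for smooth $u$, or, equivalently (this is the form to be used), if at every node it is exact for all polynomials of degree $\le p$, i.e. $\sum_j D_{ij}\,u(x_j)=u'(x_i)$ for every polynomial $u$ of degree $\le p$, with $p$ maximal. An averaging operator $A$ of order $q$ is a (not necessarily linear) map from grid functions to grid functions on each grid of the family such that $(A\mathbf{u})_i=u(x_i)+\mathcal{O}(h^q)$ for every smooth function $u$ with $\mathbf{u}_i=u(x_i)$. The product rule is meant to hold at every node on every grid of the family. *)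

(* Defs.v *)
From HB Require Import structures.
From mathcomp Require Import all_boot all_order all_algebra.
From mathcomp Require Import boolp classical_sets functions cardinality fsbigop.
From mathcomp Require Import reals topology normedtype derive.

Set Implicit Arguments.
Unset Strict Implicit.
Unset Printing Implicit Defensive.

Import Order.TTheory GRing.Theory Num.Theory.
Import numFieldNormedType.Exports.

Local Open Scope classical_set_scope.
Local Open Scope ring_scope.

(* The nodes are indexed by an interval of consecutive integers, so finite,
   one-sided and two-sided infinite grids are all covered; [position i] is
   meaningless for [i \notin index_set]. *)
Record grid (R : realType) := Grid {
  index_set : interval int;
  position : int -> R;
  grid_step : R;
  pos_incr : {in index_set &, forall i j, i < j -> position i < position j};
  (* [grid_step] is the minimum (attained) of the gaps between neighbouring nodes;
     in particular there are at least two nodes and [0 < grid_step]. *)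
  step_attained : exists i : int,
    [/\ i \in index_set, i + 1 \in index_set & grid_step = position (i + 1) - position i];
  step_min : forall i : int, i \in index_set -> i + 1 \in index_set ->
    grid_step <= position (i + 1) - position i
}.

Definition node_index (R : realType) (G : grid R) := {i : int | i \in index_set G}.

Definition node (R : realType) (G : grid R) (i : node_index G) : R := position G (val i).

Definition gridfun (R : realType) (G : grid R) := node_index G -> R.

Definition sample (R : realType) (G : grid R) (u : R -> R) : gridfun G :=
  fun i => u (node i).

(* A family indexed by an arbitrary type [K] along which "h -> 0" makes sense;
   this includes every sequence of grids whose grid_step tends to [0]. *)
Definition refining (R : realType) (K : Type) (G : K -> grid R) :=
  forall e : R, 0 < e -> exists k : K, grid_step (G k) < e.

Record matrix_operator (R : realType) (G : grid R) := MatrixOperator {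
  entry : node_index G -> node_index G -> R;
  entry_finite : forall i, finite_set [set j | entry i j != 0]
}.

(* [\sum_(j \in setT)] sums over the finite support of the summand, which is
   contained in the finite support of the row. *)
Definition apply_op (R : realType) (G : grid R) (D : matrix_operator G)
    (u : gridfun G) : gridfun G :=
  fun i => \sum_(j \in [set: node_index G]) (entry D i j * u j).

Definition exact_upto (R : realType) (K : Type) (G : K -> grid R)
    (D : forall k, matrix_operator (G k)) (p : nat) :=
  forall u : {poly R}, (size u <= p.+1)%N ->
  forall k (i : node_index (G k)),
    apply_op (D k) (sample (horner u)) i = (deriv u).[node i].

Definition derivative_of_order (R : realType) (K : Type) (G : K -> grid R)
    (D : forall k, matrix_operator (G k)) (p : nat) :=
  exact_upto D p /\ (forall p' : nat, exact_upto D p' -> (p' <= p)%N).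

Definition smooth (R : realType) (u : R -> R) :=
  forall (n : nat) (x : R), derivable (derive1n n u) x 1.

(* The constant in O(h^q) is uniform over the nodes in a bounded region:
   [u] ranges over all smooth functions on the line and an individual index
   has no meaning across different grids.  For grids in a fixed bounded interval
   this is uniformity over all nodes. *)
Definition averaging_of_order (R : realType) (K : Type) (G : K -> grid R)
    (A : forall k, gridfun (G k) -> gridfun (G k)) (q : nat) :=
  forall u : R -> R, smooth u -> forall M : R,
  exists C h0 : R, 0 < h0 /\
    forall k (i : node_index (G k)), grid_step (G k) < h0 -> `|node i| <= M ->
      `|A k (sample u) i - u (node i)| <= C * grid_step (G k) ^+ q.

Definition product_rule (R : realType) (K : Type) (G : K -> grid R)
    (D : forall k, matrix_operator (G k))
    (A : forall k, gridfun (G k) -> gridfun (G k)) :=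
  forall k (u v : gridfun (G k)),
    apply_op (D k) (u \* v)
    = (A k u \* apply_op (D k) v) \+ (apply_op (D k) u \* A k v).

(* Main.v *)
Require Import Defs.
From mathcomp Require Import all_boot all_order all_algebra.
From mathcomp Require Import reals.
From mathcomp Require Import boolp classical_sets functions cardinality fsbigop.

(** At a node [x], centre everything at [x] and write [w = 'X - x]. Exactness up
    to degree [p] means that, at that node, [D] annihilates [w ^+ n] for
    [2 <= n <= p]. The product rule shows that when [D] annihilates [u] and [v]
    at a node, it also annihilates [u * v] there, whatever the values of [A]
    (lemma [product_rule_apply_op0]). Since [p > 2], the degree [p + 1] splits as
    [2 + (p - 1)] with both parts between [2] and [p], so [D] annihilates
    [w ^+ (p + 1)] as well. By linearity [D] is then exact up to degree [p + 1] at
    every node ([exact_upto_succ]), which contradicts the maximality of [p].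
    The argument is purely algebraic: it uses no approximation property of [A],
    and works on each grid separately. *)

Set Implicit Arguments.
Unset Strict Implicit.
Unset Printing Implicit Defensive.

Import GRing.Theory.

Local Open Scope classical_set_scope.
Local Open Scope ring_scope.

(* The finite support of the row does not depend on the grid function, unlike the
   one implicit in [apply_op]; it serves as common index set for additivity. *)
Lemma apply_op_row_support (R : realType) (G : grid R) (D : matrix_operator G)
    (u : gridfun G) (i : node_index G) :
  apply_op D u i = \sum_(j \in [set j | entry D i j != 0]) (entry D i j * u j).
Proof.
rewrite /apply_op; apply/esym/fsbig_widen => // j [_ /= /negP].
by rewrite negbK => /eqP ->; rewrite mul0r.
Qed.

Lemma apply_opD (R : realType) (G : grid R) (D : matrix_operator G)
    (u v : gridfun G) (i : node_index G) :
  apply_op D (u \+ v) i = apply_op D u i + apply_op D v i.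
Proof.
rewrite !apply_op_row_support -fsbig_split /=; last exact: entry_finite.
by apply: eq_fsbigr => j _; rewrite mulrDr.
Qed.

Lemma apply_opZ (R : realType) (G : grid R) (D : matrix_operator G)
    (c : R) (u : gridfun G) (i : node_index G) :
  apply_op D (fun j => c * u j) i = c * apply_op D u i.
Proof.
rewrite /apply_op mulr_fsumr.
by apply: eq_fsbigr => j _; rewrite mulrCA.
Qed.

Lemma product_rule_apply_op0 (R : realType) (K : Type) (G : K -> grid R)
    (D : forall k, matrix_operator (G k))
    (A : forall k, gridfun (G k) -> gridfun (G k)) (k : K)
    (u v : gridfun (G k)) (i : node_index (G k)) :
  product_rule D A -> apply_op (D k) u i = 0 -> apply_op (D k) v i = 0 ->
  apply_op (D k) (u \* v) i = 0.
Proof. by move=> DA Du Dv; rewrite DA /= Du Dv mulr0 mul0r addr0. Qed.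

Lemma size_exp_XsubC_sub_le (R : idomainType) (x : R) (n : nat) (u : {poly R}) :
  (size u <= n.+1)%N -> (size (u - u`_n *: ('X - x%:P) ^+ n)%R <= n)%N.
Proof.
move=> su; apply/leq_sizeP => j; rewrite leq_eqVlt => /predU1P[<-|nj].
  have := lead_coef_exp ('X - x%:P) n.
  rewrite lead_coefXsubC expr1n lead_coefE size_exp_XsubC /= => lc.
  by rewrite coefB coefZ lc mulr1 subrr.
rewrite coefB coefZ [_`_j]nth_default; last exact: leq_trans su nj.
by rewrite [_`_j]nth_default ?size_exp_XsubC // mulr0 subr0.
Qed.

Lemma deriv_exp_XsubC_root (R : comNzRingType) (x : R) (n : nat) :
  (1 < n)%N -> ((('X - x%:P) ^+ n)^`()).[x] = 0.
Proof.
case: n => [|[|n]] // _.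
by rewrite deriv_exp derivXsubC mul1r hornerMn horner_exp hornerXsubC subrr
  expr0n mul0rn.
Qed.

Lemma exact_upto_exp_XsubC0 (R : realType) (K : Type) (G : K -> grid R)
    (D : forall k, matrix_operator (G k)) (p n : nat) (k : K)
    (i : node_index (G k)) :
  exact_upto D p -> (1 < n <= p)%N ->
  apply_op (D k) (sample (horner (('X - (node i)%:P) ^+ n))) i = 0.
Proof.
move=> Dp /andP[n1 np].
by rewrite Dp ?size_exp_XsubC // deriv_exp_XsubC_root.
Qed.

(** The product rule propagates exactness to the next degree. *)
Lemma exact_upto_succ (R : realType) (K : Type) (G : K -> grid R)
    (D : forall k, matrix_operator (G k))
    (A : forall k, gridfun (G k) -> gridfun (G k)) (p : nat) :
  (2 < p)%N -> product_rule D A -> exact_upto D p -> exact_upto D p.+1.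
Proof.
move=> p2 DA Dp u su k i.
set w := 'X - (node i)%:P.
have Dw0 : apply_op (D k) (sample (horner (w ^+ p.+1))) i = 0.
  (* p + 1 = 2 + (p - 1), where both exponents lie between 2 and p *)
  have -> : sample (horner (w ^+ p.+1))
      = sample (horner (w ^+ 2)) \* sample (horner (w ^+ p.-1)) :> gridfun (G k).
    apply/funext => j /=; rewrite /sample -hornerM -exprD.
    by case: p p2 {Dp su}.
  apply: (product_rule_apply_op0 DA); apply: exact_upto_exp_XsubC0 Dp _.
    exact: ltnW.
  by case: p p2 {su} => // p p2; rewrite /= leqnSn andbT.
set c := u`_p.+1; set r := u - c *: w ^+ p.+1.
have ur : u = r + c *: w ^+ p.+1 by rewrite subrK.
have sr : (size r <= p.+1)%N by exact: size_exp_XsubC_sub_le.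
have -> : sample (horner u)
    = sample (horner r) \+ (fun j => c * sample (horner (w ^+ p.+1)) j)
      :> gridfun (G k).
  by apply/funext => j /=; rewrite /sample [in LHS]ur hornerD hornerZ.
rewrite apply_opD apply_opZ Dw0 mulr0 addr0 Dp // [in RHS]ur derivD derivZ.
by rewrite hornerD hornerZ deriv_exp_XsubC_root ?mulr0 ?addr0 // ltnW // ltnW.
Qed.

Theorem theorem3p6 (R : realType) (K : Type) (G : K -> grid R)
    (hG : refining G) (D : forall k : K, matrix_operator (G k)) (p : nat)
    (hD : derivative_of_order D p) (hp : (2 < p)%N) :
  ~ exists (q : nat) (A : forall k : K, gridfun (G k) -> gridfun (G k)),
      averaging_of_order A q /\ product_rule D A.
Proof.
move=> [q [A [_ DA]]]; case: hD => Dp pmax.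
by have := pmax _ (exact_upto_succ hp DA Dp); rewrite ltnn.
Qed.
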